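(* Let $\Omega=(a,b)$ with real numbers $a<b$. For all grid sizes $h$, each $q\in\mathbb{N}_0$, each $p\in\mathbb{N}$ and each $r\in\mathbb{N}_0$ with $0\le r\le q\le p+1$ and $h(p-r)<|\Omega|$, there is for each $u\in H^q(\Omega)$ a spline approximation $u_{p,h}\in S_{p,h}(\Omega)$ such that $$|u-u_{p,h}|_{H^r(\Omega)}\le(\sqrt{2}\,h)^{q-r}\,|u|_{H^q(\Omega)}.$$
   Context: $\mathbb{N}=\{1,2,3,\ldots\}$, $\mathbb{N}_0=\mathbb{N}\cup\{0\}$, $|\Omega|=b-a$. A grid size for $\Omega=(a,b)$ is a real $h>0$ such that $n_h:=h^{-1}(b-a)\in\mathbb{N}$. $H^r(\Omega)$ is the standard Sobolev space ($H^0=L^2$) and $|u|_{H^r(\Omega)}:=\|\frac{\partial^r}{\partial x^r}u\|_{L^2(\Omega)}$ (so $|u|_{H^0(\Omega)}=\|u\|_{L^2(\Omega)}$); the estimate includes that $u-u_{p,h}\in H^r(\Omega)$. $\mathbb{P}^p$ is the space of polynomials of degree at most $p$, and $$S_{p,h}(\Omega):=\{u\in H^p(\Omega): u|_{(a+hj,a+h(j+1)]}\in\mathbb{P}^p\text{ for all }j=0,\ldots,n_h-1\}.$$ *)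

(* Defs.v *)
From HB Require Import structures.
From mathcomp Require Import all_boot all_order all_algebra.
From mathcomp Require Import all_classical all_reals all_analysis.

Set Implicit Arguments.
Unset Strict Implicit.
Unset Printing Implicit Defensive.

Import Order.TTheory GRing.Theory Num.Theory.
Import numFieldNormedType.Exports.

Local Open Scope classical_set_scope.
Local Open Scope ring_scope.

(* Functions on Omega = `]a, b[ are represented by
   total functions R -> R; their values outside Omega are irrelevant to all
   the notions below except [spline_space], which also reads the value at b. *)

(* [f \_ D] is f on D and 0 elsewhere. *)
Definition L2 (R : realType) (a b : R) (u : R -> R) : Prop :=
  (u \_ `]a, b[) \in Lfun (@lebesgue_measure R) 2%:E.

(* The Lnorm is extended-real valued; it is finite whenever [L2 a b u]. *)
Definition L2_norm (R : realType) (a b : R) (u : R -> R) : R :=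
  fine 'N[@lebesgue_measure R]_2%:E [EFin \o (u \_ `]a, b[)]%E.

Definition test_function (R : realType) (a b : R) (phi : R -> R) : Prop :=
  [/\ forall (n : nat) (x : R), derivable (phi^`(n))%classic x 1,
      compact (closure [set x | phi x != 0]) &
      closure [set x | phi x != 0] `<=` `]a, b[ ].

Definition is_weak_derivative (R : realType) (a b : R) (k : nat)
    (u v : R -> R) : Prop :=
  forall phi : R -> R, test_function a b phi ->
    \int[@lebesgue_measure R]_(x in `]a, b[) (u x * (phi^`(k))%classic x) =
    (-1) ^+ k * \int[@lebesgue_measure R]_(x in `]a, b[) (v x * phi x).

Definition sobolev (R : realType) (a b : R) (r : nat) (u : R -> R) : Prop :=
  L2 a b u /\
  forall k : nat, (k <= r)%N ->
    exists v : R -> R, L2 a b v /\ is_weak_derivative a b k u v.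

(* A chosen representative of the k-th weak derivative, which is unique up to
   equality almost everywhere on Omega; meaningful only when a square integrable
   weak derivative exists, in particular for u in H^r with k <= r. *)
Definition weak_derivative (R : realType) (a b : R) (k : nat) (u : R -> R) :
    R -> R :=
  xget (cst 0) [set v | L2 a b v /\ is_weak_derivative a b k u v].

Definition sobolev_seminorm (R : realType) (a b : R) (r : nat) (u : R -> R) :
    R :=
  L2_norm a b (weak_derivative a b r u).

Definition grid_size (R : realType) (a b h : R) : Prop :=
  0 < h /\ exists n : nat, (0 < n)%N /\ h^-1 * (b - a) = n%:R.

(* For a grid size h, the condition on j says j = 0, ..., n_h - 1.  The
   polynomial identity is asked pointwise: every H^p class that is piecewise
   polynomial almost everywhere has such a representative. *)
Definition spline_space (R : realType) (a b : R) (p : nat) (h : R)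
    (u : R -> R) : Prop :=
  sobolev a b p u /\
  forall j : nat, j%:R < h^-1 * (b - a) ->
    exists P : {poly R}, (size P <= p.+1)%N /\
      forall x : R, a + h * j%:R < x <= a + h * j.+1%:R -> u x = P.[x].

(* Main.v *)
(* Let K f (x) be the integral of f from a to x, S_0 the piecewise constants and
   S_(m+1) = constants + K S_m. If e is orthogonal to S_m, then |K e| <= h |e|:
   for m = 0, K e vanishes at the knots; for m > 0, K e is orthogonal to S_(m-1)
   and vanishes at both ends, so |K e|^2 = - <e, K K e> <= |e| h |K e| by induction.
   Let w_k be the k-th weak derivative of u, s_k its L2 projection on S_(p-k) and
   e_k = w_k - s_k. Since e_k is orthogonal to constants,
   |e_k|^2 = <e_k, w_k> = - <K e_k, w_(k+1)> = - <K e_k, e_(k+1)> <= h |e_k| |e_(k+1)|.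
   Iterating, with w_q in place of e_q at the end, gives |e_r| <= h^(q-r) |w_q|,
   and u_(p,h) is an r-fold primitive of s_r. For r = q, take u_(p,h) = 0. *)
Require Import Defs.
From HB Require Import structures.
From mathcomp Require Import all_boot all_order all_algebra.
From mathcomp Require Import all_classical all_reals all_analysis.
From mathcomp Require Import measurable_realfun ring lra.

Set Implicit Arguments.
Unset Strict Implicit.
Unset Printing Implicit Defensive.

Import Order.TTheory GRing.Theory Num.Theory.
Import numFieldNormedType.Exports.

Local Open Scope classical_set_scope.
Local Open Scope ring_scope.

(** * Square integrable functions on an interval *)

(** Every differentiation lowers the spline degree by one, and the last comparison, at k = q - 1,
    still needs degree p - q + 1 >= 0: this is the source of q <= p + 1. Boundary values of the w_k
    never appear. K is skew-adjoint up to the product of the two total integrals, a fact obtained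
    from Fubini for plain square integrable functions, and one of the two functions always has mean
    zero. The projection estimate uses a single property of consecutive weak derivatives, <e, w_k> =
    - <K e, w_(k+1)> for e of mean zero. The du Bois-Reymond argument extracts it from the
    definition, which requires a supply of explicit test functions; hence the part on bump
    functions. The constant in |K e| <= h |e| does not grow with the degree, because the duality
    step hands on the constant of the degree below; so the bound reached is h^(q-r), and 1 <= sqrt 2
    turns it into the stated one. *)

Lemma ge0_subset_Rintegral d (T : measurableType d) (R : realType)
    (mu : {measure set T -> \bar R}) (A B : set T) (f : T -> R) :
  measurable A -> measurable B -> A `<=` B -> (forall x, B x -> 0 <= f x) ->
  mu.-integrable B (EFin \o f) ->
  \int[mu]_(x in A) f x <= \int[mu]_(x in B) f x.
Proof.
move=> mA mB AB f0 fi; rewrite /Rintegral fine_le//.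
- by apply: integrable_fin_num => //; exact: integrableS fi.
- exact: integrable_fin_num.
- apply: ge0_subset_integral => //; exact: measurable_int fi.
Qed.

Section square_integrable.
Context {R : realType}.
Variables (a b : R).
Local Notation mu := (@lebesgue_measure R).
Local Notation D := (`]a, b[%classic : set (measurableTypeR R)).
Implicit Types f g w : R -> R.

Definition itg f := mu.-integrable D (EFin \o f).
(** Square integrability in a form suited to the bilinear calculus of [ip]; [L2P] and [L2_normE]
    translate back to the notions of the statement. *)
Definition sq f := measurable_fun D f /\ itg (fun x => f x ^+ 2).
Definition ip f g := \int[mu]_(x in D) (f x * g x).

Let mD : measurable D. Proof. exact: measurable_itv. Qed.

Lemma itgD f g : itg f -> itg g -> itg (f \+ g).
Proof. by move=> fi gi; apply: (eq_integrable mD _ _ _ (integrableD mD fi gi)). Qed.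

Lemma itgZ c f : itg f -> itg (fun x => c * f x).
Proof. by move=> fi; apply: (eq_integrable mD _ _ _ (integrableZl mD c fi)). Qed.

Lemma itgM f g : sq f -> sq g -> itg (fun x => f x * g x).
Proof.
move=> [mf fi] [mg gi].
apply: (le_integrable mD _ _ (itgD fi gi)).
  by apply/measurable_EFinP; exact: measurable_funM.
move=> x _ /=; rewrite lee_fin [leRHS]ger0_norm ?addr_ge0 ?sqr_ge0//.
by rewrite ler_norml; apply/andP; split; nra.
Qed.

Lemma sqD f g : sq f -> sq g -> sq (f \+ g).
Proof.
move=> sf sg; split; first by apply: measurable_funD; [exact: sf.1|exact: sg.1].
apply: (eq_integrable mD _ _ _ (itgD (itgD sf.2 sg.2) (itgZ 2 (itgM sf sg)))) => x _ /=.
by congr EFin; ring.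
Qed.

Lemma sqZ c f : sq f -> sq (fun x => c * f x).
Proof.
move=> [mf fi]; split; first exact: measurable_funM.
by apply: (eq_integrable mD _ _ _ (itgZ (c ^+ 2) fi)) => x _ /=; congr EFin; ring.
Qed.

Lemma sqB f g : sq f -> sq g -> sq (f \- g).
Proof.
move=> sf sg; have := sqD sf (sqZ (-1) sg).
by congr sq; apply/funext => x /=; ring.
Qed.

Lemma sq_cst c : sq (cst c).
Proof.
split; first exact: measurable_cst.
apply: measurable_bounded_integrable => //.
  by rewrite /= lebesgue_measure_itv/=; case: ifPn => // _; rewrite -EFinB ltry.
  exact/measurable_funX/measurable_cst.
by exists `|c ^+ 2|; split=> [|M cM x _]; [exact: num_real|exact: ltW].
Qed.

Lemma sq0 : sq (fun _ => 0).
Proof. exact: (sq_cst 0). Qed.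

Lemma sq_itg f : sq f -> itg f.
Proof.
move=> sf; apply: (eq_integrable mD _ _ _ (itgM sf (sq_cst 1))) => x _ /=.
by rewrite mulr1.
Qed.

Lemma bounded_sq f M : measurable_fun D f -> (forall x, D x -> `|f x| <= M) -> sq f.
Proof.
move=> mf fM; split => //.
apply: (le_integrable mD _ _ (sq_itg (sq_cst (M ^+ 2)))).
  by apply/measurable_EFinP; exact: measurable_funX.
move=> x Dx /=; rewrite lee_fin ger0_norm ?sqr_ge0// ger0_norm ?sqr_ge0//.
by rewrite -real_normK ?num_real// ler_pXn2r ?nnegrE//; [exact: fM|exact: le_trans (fM _ Dx)].
Qed.

Lemma ipC f g : ip f g = ip g f.
Proof. by apply: eq_Rintegral => x _; rewrite mulrC. Qed.

Lemma eq_ip f g w : {in D, f =1 g} -> ip f w = ip g w.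
Proof. by move=> fg; apply: eq_Rintegral => x xD; rewrite fg. Qed.

Lemma ipDl f g w : sq f -> sq g -> sq w -> ip (f \+ g) w = ip f w + ip g w.
Proof.
move=> sf sg sw; rewrite /ip -RintegralD//; [|exact: itgM..].
by apply: eq_Rintegral => x _ /=; rewrite mulrDl.
Qed.

Lemma ipBl f g w : sq f -> sq g -> sq w -> ip (f \- g) w = ip f w - ip g w.
Proof.
move=> sf sg sw; rewrite /ip -RintegralB//; [|exact: itgM..].
by apply: eq_Rintegral => x _ /=; rewrite mulrBl.
Qed.

Lemma ipZl c f w : sq f -> sq w -> ip (fun x => c * f x) w = c * ip f w.
Proof.
move=> sf sw; rewrite /ip -RintegralZl//; last exact: itgM.
by apply: eq_Rintegral => x _ /=; rewrite mulrA.
Qed.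

Lemma ipBr f g w : sq f -> sq g -> sq w -> ip w (f \- g) = ip w f - ip w g.
Proof. by move=> *; rewrite ipC ipBl// 2!(ipC w). Qed.

Lemma ip0l w : ip (fun _ => 0) w = 0.
Proof.
rewrite /ip; under eq_Rintegral do rewrite mul0r.
by rewrite Rintegral_cst ?mul0r.
Qed.

Lemma ip_ge0 f : 0 <= ip f f.
Proof. by apply: Rintegral_ge0 => x _; rewrite -expr2 sqr_ge0. Qed.

Lemma cauchy_schwarz f g : sq f -> sq g -> ip f g ^+ 2 <= ip f f * ip g g.
Proof.
move=> sf sg.
have H (s t : R) : 0 <= s ^+ 2 * ip f f - 2 * s * t * ip f g + t ^+ 2 * ip g g.
  have /= := ip_ge0 ((fun x => s * f x) \- (fun x => t * g x)).
  have ? := sqZ s sf; have ? := sqZ t sg.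
  rewrite ipBl ?ipBr//; last exact: sqB.
  by rewrite !ipZl// !(ipC _ (fun x => _ * _ x)) !ipZl// (ipC g f); nra.
have [g0|g0] := eqVneq (ip g g) 0.
  (* With <g, g> = 0, s = <f, g> and t = <f, f> / 2 + 1, the quadratic form equals -2 <f, g>^2. *)
  have := H (ip f g) (ip f f * 2^-1 + 1); rewrite g0 => {}H.
  have {}H : ip f g ^+ 2 <= 0 by have := ip_ge0 f; nra.
  by rewrite mulr0.
have gp : 0 < ip g g by rewrite lt_neqAle eq_sym g0 ip_ge0.
have := H (ip g g) (ip f g).
have -> : ip g g ^+ 2 * ip f f - 2 * ip g g * ip f g * ip f g +
  ip f g ^+ 2 * ip g g = ip g g * (ip f f * ip g g - ip f g ^+ 2) by ring.
by rewrite pmulr_rge0// subr_ge0.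
Qed.

Definition nrm f := Num.sqrt (ip f f).

Lemma nrm_ge0 f : 0 <= nrm f. Proof. exact: sqrtr_ge0. Qed.

Lemma nrm_sqr f : nrm f ^+ 2 = ip f f.
Proof. by rewrite sqr_sqrtr// ip_ge0. Qed.

Lemma ip_le_nrm f g : sq f -> sq g -> `|ip f g| <= nrm f * nrm g.
Proof.
move=> sf sg; rewrite -(@ler_pXn2r _ 2)// ?nnegrE ?mulr_ge0 ?nrm_ge0//.
by rewrite real_normK ?num_real// exprMn !nrm_sqr cauchy_schwarz.
Qed.

Lemma L2P f : L2 a b f <-> sq f.
Proof.
rewrite /L2 /sq /itg; split.
  move=> /[dup] /Lfun2_integrable_sqr fi.
  rewrite inE => /andP[+ _]; rewrite inE/= => mf; split.
    exact/(measurable_restrictT _ _).2.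
  apply/integrable_mkcond => //.
  apply: (eq_integrable _ _ _ _ fi) => // x _ /=.
  by rewrite !patchE; case: ifP => //; rewrite expr0n.
move=> [mf fi].
have mf' : measurable_fun setT (f \_ D) by exact/(measurable_restrictT _ _).1.
rewrite inE; apply/andP; split; first by rewrite inE.
rewrite inE /finite_norm /= unlock poweR_lty//.
move/(integrable_mkcond _ mD).1 : fi => /integrableP[_].
apply: le_lt_trans; rewrite le_eqVlt; apply/orP; left; apply/eqP.
apply: eq_integral => x _ /=; rewrite !patchE; case: ifP => _ /=.
  by rewrite powR_mulrn// normrX.
by rewrite normr0 powR0.
Qed.

Lemma L2_normE f : L2_norm a b f = nrm f.
Proof.
rewrite /L2_norm unlock.
have -> : (\int[mu]_x `|(EFin \o (f \_ D)) x| `^ 2 = \int[mu]_(x in D) (f x * f x)%:E)%E.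
  rewrite [RHS]integral_mkcond; apply: eq_integral => x _ /=.
  rewrite !patchE; case: ifP => _ /=; last by rewrite normr0 powR0.
  by rewrite powR_mulrn// real_normK ?num_real// expr2.
rewrite /nrm /ip /Rintegral -powR12_sqrt; last first.
  by rewrite fine_ge0// integral_ge0// => x _; rewrite lee_fin -expr2 sqr_ge0.
have : (0 <= \int[mu]_(x in D) (f x * f x)%:E)%E.
  by rewrite integral_ge0// => x _; rewrite lee_fin -expr2 sqr_ge0.
(* If the integral is infinite, [fine] sends both sides to 0, so no integrability of f is
   assumed. *)
case: (integral _ _ _) => [s _ //|_|//].
by rewrite poweRyr ?invr_eq0//= powR0 ?invr_eq0.
Qed.

End square_integrable.

(** * Primitives *)

Section primitive.
Context {R : realType}.
Variables (a b : R).
Local Notation mu := (@lebesgue_measure R).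
Local Notation D := (`]a, b[%classic : set (measurableTypeR R)).
Implicit Types f g w : R -> R.

(** The open interval makes [primitive a f b] convertible to the integral over D. For x <= a the
    value is 0, not a signed integral. *)
Definition primitive f (x : R) : R := \int[mu]_(t in `]a, x[) f t.

Let mD : measurable D. Proof. exact: measurable_itv. Qed.

(* Integrating this kernel over the square in both orders gives integration by
   parts without any regularity of f and g. *)
Let under_diag f g (z : measurableTypeR R * measurableTypeR R) : R :=
  if z.2 < z.1 then (g \_ D) z.1 * (f \_ D) z.2 else 0.

Let itgT f : itg a b f -> mu.-integrable setT (EFin \o (f \_ D)).
Proof. by move=> /(integrable_mkcond _ mD).1; rewrite restrict_EFin. Qed.

Let integrable_under_diag f g : itg a b f -> itg a b g ->
  (mu \x mu)%E.-integrable setT (EFin \o under_diag f g).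
Proof.
move=> /itgT fi /itgT gi.
have mf : measurable_fun (setT : set (measurableTypeR R)) (f \_ D).
  by move/integrableP: fi => [/measurable_EFinP].
have mg : measurable_fun (setT : set (measurableTypeR R)) (g \_ D).
  by move/integrableP: gi => [/measurable_EFinP].
have mfg : measurable_fun (setT : set (measurableTypeR R * measurableTypeR R))
    (fun z => (g \_ D) z.1 * (f \_ D) z.2).
  by apply: measurable_funM; apply: measurableT_comp.
apply: (@le_integrable _ _ _ _ _ _ _ (fun z => ((g \_ D) z.1 * (f \_ D) z.2)%:E)) => //.
- apply/measurable_EFinP/measurable_fun_ifT => //.
  by apply: measurable_fun_ltr; [exact: measurable_snd|exact: measurable_fst].
- by move=> z _; rewrite /under_diag /=; case: ifP => // _; rewrite normr0 lee_fin.
apply/integrable12ltyP; first exact/measurable_EFinP.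
rewrite (eq_integral (fun x =>
    `|((g \_ D) x)%:E| * \int[mu]_y `|((f \_ D) y)%:E|)%E); last first.
  move=> x _; rewrite -ge0_integralZl//; last by do 2 apply: measurableT_comp => //.
  by apply: eq_integral => y _; rewrite /= normrM EFinM.
have [_ fi'] := integrableP _ _ _ fi; have [_ gi'] := integrableP _ _ _ gi.
rewrite ge0_integralZr//.
- by rewrite lte_mul_pinfty ?integral_ge0// ge0_fin_numE ?integral_ge0.
- by do 2 apply: measurableT_comp => //.
- by rewrite integral_ge0.
Qed.



Lemma itg_sub f (I : interval R) :
  itg a b f -> [set` I] `<=` D -> mu.-integrable [set` I] (EFin \o f).
Proof. by move=> fi ID; apply: integrableS fi => //; exact: measurable_itv. Qed.

Let subl x : x \in D -> `]a, x[ `<=` D.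
Proof.
rewrite inE/= in_itv/= => /andP[_ xb] y /=; rewrite !in_itv/= => /andP[-> /=].
by move=> /lt_trans; apply.
Qed.

Let subr x : x \in D -> `]x, b[ `<=` D.
Proof.
rewrite inE/= in_itv/= => /andP[ax _] y /=; rewrite !in_itv/= => /andP[xy ->].
by rewrite (lt_trans ax).
Qed.

Let fubini_F_under_diag f g : itg a b f ->
  fubini_F mu (EFin \o under_diag f g) =
  EFin \o ((fun x => g x * primitive f x) \_ D).
Proof.
move=> fi; apply/funext => x; rewrite /fubini_F /under_diag /=.
rewrite [in RHS]patchE; case: ifPn => [xD|xD]; last first.
  by rewrite integral0_eq// => y _; rewrite patchE (negbTE xD) mul0r; case: ifP.
have fx : mu.-integrable `]a, x[ (EFin \o f) by apply: itg_sub fi (subl xD).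
rewrite EFinM /primitive /Rintegral fineK ?integrable_fin_num//.
rewrite -integralZl// [RHS]integral_mkcond; apply: eq_integral => y _.
move: (xD); rewrite inE/= in_itv/= => /andP[ax xb].
rewrite !patchE xD !mem_setE/= !in_itv/=; have [yx|xy] := ltP y x; last by rewrite andbF.
by rewrite (lt_trans yx xb) andbT; case: ifP; rewrite ?mulr0.
Qed.

Let fubini_G_under_diag f g : itg a b f -> itg a b g ->
  fubini_G mu (EFin \o under_diag f g) =
  EFin \o ((fun x => f x * (\int[mu]_(t in D) g t - primitive g x)) \_ D).
Proof.
move=> fi gi; apply/funext => x; rewrite /fubini_G /under_diag /=.
rewrite [in RHS]patchE; case: ifPn => [xD|xD]; last first.
  by rewrite integral0_eq// => y _; rewrite (patchE f) (negbTE xD) mulr0; case: ifP.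
have gx : mu.-integrable `]x, b[ (EFin \o g) by apply: itg_sub gi (subr xD).
(* Closing the interval at x makes its complement in D exactly []x, b[], the section of the
   kernel. *)
rewrite /primitive Rintegral_itv_bndo_bndc; last exact: itg_sub gi (subl xD).
move: (xD); rewrite inE/= in_itv/= => /andP[ax xb].
rewrite Rintegral_itvB//; [|by rewrite bnd_simp ltW..].
rewrite EFinM /primitive /Rintegral fineK ?integrable_fin_num//.
rewrite -integralZl// [RHS]integral_mkcond; apply: eq_integral => y _.
rewrite !patchE xD !mem_setE/= !in_itv/=; have [yx|xy] := ltP x y; last by [].
by rewrite (lt_trans ax yx) /=; case: ifP; rewrite ?mul0r// mulrC.
Qed.

(** Fubini provides measurability: for g = 1 the inner integral of [under_diag] is the primitive of
    f on D. *)
Lemma measurable_primitive f : itg a b f -> measurable_fun D (primitive f).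
Proof.
move=> fi; have gi := sq_itg (@sq_cst R a b 1).
have := measurable_fubini_F (integrable_under_diag fi gi).
rewrite fubini_F_under_diag// => /measurable_EFinP/(measurable_restrictT _ mD).2.
by apply: eq_measurable_fun => x _; rewrite /= mul1r.
Qed.

Lemma primitive_bound f x : itg a b f -> D x ->
  `|primitive f x| <= \int[mu]_(t in D) `|f t|.
Proof.
move=> fi xD; have sx := subl (mem_set xD).
apply: (le_trans (le_normr_Rintegral _ (itg_sub fi sx))) => //.
by apply: ge0_subset_Rintegral => //; exact: integrable_norm.
Qed.

Lemma sq_primitive f : itg a b f -> sq a b (primitive f).
Proof.
move=> fi; apply: (bounded_sq (measurable_primitive fi)) => x Dx.
exact: primitive_bound.
Qed.

(** Equating the two iterated integrals of [under_diag] gives <g, K f> = <f, G - K g>, where G is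
    the integral of g over D. The right-hand side is the boundary term at b; both primitives vanish
    at a. *)
Lemma integration_by_parts_primitive f g : sq a b f -> sq a b g ->
  ip a b (primitive f) g + ip a b f (primitive g) =
  (\int[mu]_(t in D) f t) * (\int[mu]_(t in D) g t).
Proof.
move=> sf sg; have fi := sq_itg sf; have gi := sq_itg sg.
have sF := sq_primitive fi; have sG := sq_primitive gi.
have ud := integrable_under_diag fi gi.
have := integral12_prod_meas1 ud; rewrite -integral21_prod_meas1//.
rewrite fubini_F_under_diag// fubini_G_under_diag// -!restrict_EFin.
rewrite -!integral_mkcond => /(congr1 fine); rewrite -!/(Rintegral _ _ _) => H.
rewrite ipC {1}/ip H.
rewrite -RintegralZr// -[X in _ + X = _]/(ip a b _ _) -[RHS](subrK (ip a b f (primitive g))).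
congr (_ + _); rewrite -RintegralB//; last 2 first.
- exact: (itgM sf (sq_cst a b (\int[mu]_(t in D) g t))).
- exact: itgM.
by apply: eq_Rintegral => x _; rewrite mulrBr.
Qed.

End primitive.

(** * Spline generators and projection estimates *)

Section span.
Context {R : realType}.
Variables (a b : R).
Implicit Types (f g s t w : R -> R) (G : seq (R -> R)).

(** A span without coefficient vectors: properties stable under s + c g pass from the generators by
    induction, and redundant generators do no harm. *)
Inductive lspan G : (R -> R) -> Prop :=
| lspan0 : lspan G (fun _ => 0)
| lspanD s c g : lspan G s -> g \in G -> lspan G (fun x => s x + c * g x).

Lemma lspanDZ G s t c : lspan G s -> lspan G t -> lspan G (fun x => s x + c * t x).
Proof.
move=> Gs; elim=> [|{}t d g _ IH gG].
  by congr lspan: Gs; apply/funext => x; rewrite mulr0 addr0.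
have := lspanD (c * d) IH gG.
by congr lspan; apply/funext => x; ring.
Qed.

Lemma lspan_mem G g : g \in G -> lspan G g.
Proof.
move=> gG; have := lspanD 1 (lspan0 G) gG.
by congr lspan; apply/funext => x; rewrite add0r mul1r.
Qed.

Lemma lspanS G g s : lspan G s -> lspan (g :: G) s.
Proof.
elim=> [|{}s c f _ IH fG]; first exact: lspan0.
by apply: lspanD IH _; rewrite inE fG orbT.
Qed.

Lemma sq_lspan G s : {in G, forall g, sq a b g} -> lspan G s -> sq a b s.
Proof.
move=> sG; elim=> [|{}s c g _ IH gG]; first exact: sq0.
exact: (sqD IH (sqZ c (sG _ gG))).
Qed.

Lemma ip_lspan G e s : {in G, forall g, sq a b g} -> sq a b e ->
  {in G, forall g, ip a b e g = 0} -> lspan G s -> ip a b e s = 0.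
Proof.
move=> sG se eG; elim=> [|{}s c g Gs IH gG]; first by rewrite ipC ip0l.
rewrite ipC ipDl//; [|exact: sq_lspan Gs|exact/sqZ/sG].
by rewrite ipZl//; [rewrite 2!(ipC _ _ _ e) IH eG// mulr0 addr0|exact: sG].
Qed.

(** Gram-Schmidt, one generator at a time: the projection on the tail is corrected by the component
    of w along g', the part of g orthogonal to the tail. *)
Lemma projection_exists G w : {in G, forall g, sq a b g} -> sq a b w ->
  exists s, lspan G s /\ {in G, forall g, ip a b (w \- s) g = 0}.
Proof.
elim: G w => [|g G IH] w sG sw; first by exists (fun _ => 0); split => //; exact: lspan0.
have sg : sq a b g by apply: sG; rewrite mem_head.
have sG' : {in G, forall g, sq a b g}.
  by move=> f fG; apply: sG; rewrite inE fG orbT.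
have [p [Gp pP]] := IH g sG' sg; have [s [Gs sP]] := IH w sG' sw.
have sp := sq_lspan sG' Gp; have ss := sq_lspan sG' Gs.
pose g' := g \- p; pose w' := w \- s.
have sg' : sq a b g' by exact: sqB.
have sw' : sq a b w' by exact: sqB.
pose c := ip a b w' g' / ip a b g' g'.
have E : w \- (fun x => s x + c * g' x) = w' \- (fun x => c * g' x).
  by apply/funext => x; rewrite /w' /=; ring.
have orthG : {in G, forall f, ip a b (w' \- (fun x => c * g' x)) f = 0}.
  move=> f fG; rewrite ipBl ?ipZl//; [|exact: sG'|exact: sqZ|exact: sG'].
  by rewrite sP// pP// mulr0 subr0.
exists (fun x => s x + c * g' x); split.
  apply: lspanDZ; first exact: lspanS.
  have := lspanDZ (-1) (lspan_mem (mem_head g G)) (lspanS g Gp).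
  by congr lspan; apply/funext => x; rewrite /g' /=; ring.
rewrite E => f; rewrite inE => /predU1P[->|/orthG//].
have -> : g = g' \+ p by apply/funext => x; rewrite /g' /= subrK.
have sd : sq a b (w' \- (fun x => c * g' x)) by apply: sqB => //; exact: sqZ.
rewrite ipC ipDl// (ipC _ _ p) (ip_lspan sG' sd orthG Gp) addr0.
rewrite ipC ipBl ?ipZl//; last exact: sqZ.
(* If g depends on the tail up to a null set, g' has norm 0; the correction then contributes
   nothing, and Cauchy-Schwarz gives <w', g'> = 0. *)
have [g0|g0] := eqVneq (ip a b g' g') 0; last by rewrite /c divfK ?subrr.
have := cauchy_schwarz sw' sg'; rewrite g0 !mulr0 subr0 => H.
by apply/eqP; rewrite -sqrf_eq0 eq_le H sqr_ge0.
Qed.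

End span.

(** * Splines on the uniform grid and the error of their L2 projection *)

Section spline_generators.
Context {R : realType}.
Variables (a h : R) (n : nat).
Hypothesis h0 : 0 < h.
Local Notation b := (a + h * n%:R).
Local Notation mu := (@lebesgue_measure R).
Local Notation D := (`]a, b[%classic : set (measurableTypeR R)).
Implicit Types e f g w : R -> R.

Let mD : measurable D. Proof. exact: measurable_itv. Qed.

(** Half-open as in [spline_space]: the cells are disjoint, and the last one contains b. *)
Definition cell (j : nat) : set R := `]a + h * j%:R, a + h * j.+1%:R]%classic.

(* Generators of the splines of degree m and maximal smoothness; the constant is
   redundant for m = 0. *)
Fixpoint spline_gens (m : nat) : seq (R -> R) :=
  if m is m'.+1 then cst 1 :: [seq primitive a g | g <- spline_gens m']
  else cst 1 :: [seq \1_(cell j) | j <- iota 0 n].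

Lemma cst1_spline_gens m : cst 1 \in spline_gens m.
Proof. by case: m => [|m]; rewrite mem_head. Qed.

Lemma primitive_spline_gens m g :
  g \in spline_gens m -> primitive a g \in spline_gens m.+1.
Proof. by move=> gG; rewrite inE map_f ?orbT. Qed.

Lemma cell_spline_gens j : (j < n)%N -> (\1_(cell j) : R -> R) \in spline_gens 0.
Proof.
move=> jn; rewrite inE; apply/orP; right.
by apply/mapP; exists j => //; rewrite mem_iota.
Qed.

Lemma sq_spline_gens m : {in spline_gens m, forall g, sq a b g}.
Proof.
elim: m => [|m IH] g; rewrite inE => /predU1P[->|]; try exact: sq_cst.
  move=> /mapP[j _ ->]; apply: (@bounded_sq _ _ _ _ 1).
    by apply: measurable_indic; exact: measurable_itv.
  by move=> x _; rewrite indicE; case: (_ \in _); rewrite ?normr1 ?normr0.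
by move=> /mapP[f fG ->]; apply: sq_primitive; exact/sq_itg/IH.
Qed.

Lemma primitive_itvD f c d : itg a b f -> a <= c -> c <= d -> d <= b ->
  primitive a f d = primitive a f c + \int[mu]_(t in `]c, d[) f t.
Proof.
move=> fi ac + db; rewrite le_eqVlt => /predU1P[->|cd].
  by rewrite set_itvoo0 Rintegral_set0 addr0.
have fd : mu.-integrable `]a, d[ (EFin \o f).
  by apply: itg_sub fi _; apply: subset_itvl; rewrite bnd_simp.
rewrite /primitive (@Rintegral_itv_bndo_bndc _ _ c); last first.
  by apply: integrableS fd => //; apply: subset_itvl; rewrite bnd_simp ltW.
by rewrite -(@Rintegral_itvB _ f (BRight a) (BLeft d) c) ?bnd_simp// addrC subrK.
Qed.

Let knot j := a + h * j%:R.

Let knot_ge j : a <= knot j.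
Proof. by rewrite lerDl mulr_ge0// ltW. Qed.

Let knot_le j k : (j <= k)%N -> knot j <= knot k.
Proof. by move=> jk; rewrite lerD2l ler_pM2l// ler_nat. Qed.

Lemma ip_cell f j : itg a b f -> (j < n)%N ->
  ip a b f \1_(cell j) = \int[mu]_(t in `]knot j, knot j.+1[) f t.
Proof.
move=> fi jn; have -> : ip a b f \1_(cell j) = \int[mu]_(x in D `&` cell j) f x.
  rewrite Rintegral_mkcondr; apply: eq_Rintegral => x _.
  by rewrite patchE indicE; case: ifP; rewrite ?mulr1 ?mulr0.
(* All cells but the last lie inside D; the last one loses its end point b, which D excludes. *)
have [jn'|jn'] := ltnP j.+1 n.
  rewrite (_ : D `&` cell j = cell j); last first.
    rewrite setIC; apply/setIidl => x; rewrite /cell /= !in_itv/= => /andP[jx xj].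
    rewrite (le_lt_trans (knot_ge j) jx)/= (le_lt_trans xj)//.
    by rewrite ltrD2l ltr_pM2l// ltr_nat.
  rewrite Rintegral_itv_bndo_bndc//; apply: itg_sub fi _; apply: subset_itv.
    by rewrite bnd_simp knot_ge.
  by rewrite bnd_simp knot_le.
have -> : n = j.+1 by apply/eqP; rewrite eqn_leq jn jn'.
rewrite (_ : _ `&` _ = `]knot j, knot j.+1[%classic)//.
apply/seteqP; split=> x; rewrite /cell /= !in_itv/=.
  by move=> [/andP[_ ->]] /andP[->].
move=> /andP[jx xj]; rewrite xj jx ltW// andbT; split => //.
exact: le_lt_trans (knot_ge j) jx.
Qed.

(* [primitive a e] vanishes at all knots, so Cauchy-Schwarz on each cell suffices. *)
Lemma norm_primitive_orthogonal_cells e : sq a b e ->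
  {in spline_gens 0, forall g, ip a b e g = 0} ->
  nrm a b (primitive a e) <= h * nrm a b e.
Proof.
move=> se eG; have ei := sq_itg se; have sE := sq_primitive ei.
have cell0 j : (j < n)%N -> \int[mu]_(t in `]knot j, knot j.+1[) e t = 0.
  by move=> jn; rewrite -ip_cell// eG// cell_spline_gens.
have step f j : itg a b f -> (j < n)%N -> primitive a f (knot j.+1) =
    primitive a f (knot j) + \int[mu]_(t in `]knot j, knot j.+1[) f t.
  move=> fi jn.
  exact: primitive_itvD fi (knot_ge j) (knot_le (leqnSn j)) (knot_le jn).
have Eknot j : (j <= n)%N -> primitive a e (knot j) = 0.
  elim: j => [_|j IH jn].
    by rewrite /primitive /knot mulr0 addr0 set_itvoo0 Rintegral_set0.
  by rewrite step// IH ?cell0 ?addr0// ltnW.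
have sub j : (j < n)%N -> `]knot j, knot j.+1[ `<=` D.
  move=> jn; apply: subset_itv; first by rewrite bnd_simp knot_ge.
  by rewrite bnd_simp knot_le.
have e2i := se.2; have E2i := sE.2.
have bound j x : (j < n)%N -> `]knot j, knot j.+1[%classic x ->
    primitive a e x ^+ 2 <=
    h * \int[mu]_(t in `]knot j, knot j.+1[) (e t ^+ 2).
  move=> jn /=; rewrite in_itv/= => /andP[jx xj].
  have xb : x <= b by rewrite (le_trans (ltW xj))// knot_le.
  rewrite (primitive_itvD ei (knot_ge j) (ltW jx) xb) Eknot ?add0r; last exact: ltnW.
  have se' : sq (knot j) x e.
    split; first by apply: measurable_funS se.1 => //; apply: subset_itv; rewrite bnd_simp ?knot_ge.
    by apply: itg_sub e2i _; apply: subset_itv; rewrite bnd_simp ?knot_ge.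
  (* Since the primitive is 0 at the knot, its value at x is <e, 1> on []knot j, x[], and |1|^2 = x
     - knot j <= h there. *)
  have := cauchy_schwarz se' (sq_cst _ _ 1).
  rewrite /ip /=; under eq_Rintegral do rewrite mulr1.
  under [X in _ <= X * _]eq_Rintegral do rewrite -expr2.
  have -> : \int[mu]_(_ in `]knot j, x[) (1 * 1) = x - knot j.
    by rewrite Rintegral_cst//= mulr1 mul1r lebesgue_measure_itv/= lte_fin jx.
  move=> /le_trans; apply; rewrite mulrC; apply: ler_pM.
  - by rewrite subr_ge0 ltW.
  - by apply: Rintegral_ge0 => t _; exact: sqr_ge0.
  - rewrite lerBlDl (le_trans (ltW xj))// /knot -addrA lerD2l.
    by rewrite -natr1 mulrDr mulr1.
  - apply: ge0_subset_Rintegral => // [|t _|]; last exact: itg_sub e2i (sub _ jn).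
      by apply: subset_itvl; rewrite bnd_simp ltW.
    exact: sqr_ge0.
(* Induction over the knots adds up the cell estimates. Integrating the constant [bound] over a cell
   of length h yields the second factor h. *)
have Eprim j : (j <= n)%N -> primitive a (fun x => primitive a e x ^+ 2) (knot j) <=
    h ^+ 2 * primitive a (fun x => e x ^+ 2) (knot j).
  elim: j => [_|j IH jn].
    by rewrite /primitive /knot mulr0 addr0 set_itvoo0 !Rintegral_set0 mulr0.
  rewrite !step// mulrDr lerD//; first by rewrite IH// ltnW.
  have ->: h ^+ 2 * \int[mu]_(t in `]knot j, knot j.+1[) (e t ^+ 2) =
    \int[mu]_(_ in `]knot j, knot j.+1[) (h * \int[mu]_(t in `]knot j, knot j.+1[) (e t ^+ 2)).
    rewrite Rintegral_cst//= lebesgue_measure_itv/= lte_fin.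
    rewrite ltrD2l ltr_pM2l// ltr_nat leqnn/= /knot -natr1.
    by ring.
  apply: le_Rintegral => //.
  - exact: itg_sub E2i (sub _ jn).
  - exact: sq_itg (sq_cst _ _ _).
  - by move=> x; exact: bound.
have ipE f : ip a b f f = primitive a (fun x => f x ^+ 2) (knot n).
  by apply: eq_Rintegral => x _; rewrite expr2.
rewrite -(@ler_pXn2r _ 2)// ?nnegrE ?mulr_ge0 ?nrm_ge0 ?(ltW h0)//.
by rewrite exprMn !nrm_sqr !ipE Eprim.
Qed.

(* If e is orthogonal to degree m+1 splines, E = [primitive a e] is orthogonal to
   degree m splines, and |E|^2 = - <e, primitive a E> <= |e| h |E| by induction. *)
Lemma norm_primitive_orthogonal m e : sq a b e ->
  {in spline_gens m, forall g, ip a b e g = 0} ->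
  nrm a b (primitive a e) <= h * nrm a b e.
Proof.
elim: m e => [|m IH] e se eG; first exact: norm_primitive_orthogonal_cells.
have sE := sq_primitive (sq_itg se).
have e1 : \int[mu]_(t in D) e t = 0.
  rewrite -[RHS](eG _ (cst1_spline_gens _)); apply: eq_Rintegral => x _.
  by rewrite mulr1.
have ibp g : sq a b g -> ip a b (primitive a e) g = - ip a b e (primitive a g).
  move=> sg; apply/eqP; rewrite -addr_eq0.
  by rewrite integration_by_parts_primitive// e1 mul0r.
have EG : {in spline_gens m, forall g, ip a b (primitive a e) g = 0}.
  move=> g gG; rewrite ibp ?eG ?oppr0//; last exact: sq_spline_gens gG.
  exact: primitive_spline_gens.
have := IH _ sE EG; set E := primitive a e => EE.
have sEE : sq a b (primitive a E) by exact/sq_primitive/sq_itg.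
have [->|E0] := eqVneq (nrm a b E) 0; first by rewrite mulr_ge0 ?nrm_ge0 ?ltW.
have Ep : 0 < nrm a b E by rewrite lt_neqAle eq_sym E0 nrm_ge0.
rewrite -(ler_pM2r Ep) -expr2 nrm_sqr (le_trans (ler_norm _))//.
rewrite {1}/E ibp// normrN (le_trans (ip_le_nrm se sEE))//.
by rewrite mulrAC [leRHS]mulrC ler_wpM2l ?nrm_ge0.
Qed.

(* For e = w 0 - s with s the projection, |e|^2 = <e, w 0> = - <primitive a e, w 1>,
   and [primitive a e] is orthogonal to the projection of w 1 one degree lower. *)
Lemma spline_projection_estimate d m (w : nat -> R -> R) : (d <= m.+1)%N ->
  (forall i, (i <= d)%N -> sq a b (w i)) ->
  (forall i, (i < d)%N -> forall e, sq a b e -> \int[mu]_(t in D) e t = 0 ->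
     ip a b e (w i) = - ip a b (primitive a e) (w i.+1)) ->
  exists s, [/\ lspan (spline_gens m) s,
    {in spline_gens m, forall g, ip a b (w 0 \- s) g = 0} &
    nrm a b (w 0 \- s) <= h ^+ d * nrm a b (w d)].
Proof.
elim: d m w => [|d IH] m w dm sw wP;
  have [s [ms sP]] := projection_exists (@sq_spline_gens m) (sw 0%N (leq0n _));
  have ss := sq_lspan (@sq_spline_gens m) ms;
  exists s; split => //; set e := _ \- _ in sP *;
  have se : sq a b e by apply: sqB => //; exact: sw.
all: have es : ip a b e s = 0 by exact: (ip_lspan (@sq_spline_gens m) se sP ms).
all: have ew : ip a b e e = ip a b e (w 0) by rewrite {2}/e ipBr ?es ?subr0//; exact: sw.
all: have [->|e0] := eqVneq (nrm a b e) 0; first by rewrite mulr_ge0 ?exprn_ge0 ?nrm_ge0 ?ltW.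
all: have ep : 0 < nrm a b e by rewrite lt_neqAle eq_sym e0 nrm_ge0.
all: rewrite -(ler_pM2l ep) -expr2 nrm_sqr ew (le_trans (ler_norm _))//.
  by rewrite expr0 mul1r ip_le_nrm//; exact: sw.
have e1 : \int[mu]_(t in D) e t = 0.
  rewrite -[RHS](sP _ (cst1_spline_gens _)); apply: eq_Rintegral => x _.
  by rewrite mulr1.
rewrite wP// normrN.
have sE := sq_primitive (sq_itg se).
have Ee := norm_primitive_orthogonal se sP.
(* When one derivative is left, [w 1] ends the sequence and stays unprojected, as m may be 0.
   Otherwise the degree bound forces m > 0, and [w 1] can be projected one degree lower. *)
case: d => [|d] in IH dm sw wP *.
  rewrite expr1 mulrA (mulrC _ h).
  rewrite (le_trans (ip_le_nrm sE (sw 1%N _)))// ler_wpM2r ?nrm_ge0//.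
case: m => [//|m] in dm sP ms Ee *.
have [s' [ms' sP' es']] := IH m (fun i => w i.+1) dm (fun i => sw i.+1) (fun i => wP i.+1).
have ss' := sq_lspan (@sq_spline_gens m) ms'.
(* Moving the primitive onto a generator g of degree m gives a generator of degree m + 1, to which e
   is orthogonal. *)
have Es' : ip a b (primitive a e) s' = 0.
  apply: (ip_lspan (@sq_spline_gens m) sE _ ms') => g gG.
  have sg := sq_spline_gens gG.
  have := integration_by_parts_primitive se sg.
  by rewrite e1 mul0r (sP (primitive a g)) ?addr0//; exact: primitive_spline_gens.
have sw1 : sq a b (w 1) by exact: sw.
have -> : ip a b (primitive a e) (w 1) = ip a b (primitive a e) (w 1 \- s').
  by rewrite ipBr// Es' subr0.
rewrite (le_trans (ip_le_nrm sE (sqB sw1 ss')))//.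
rewrite exprS -mulrA mulrCA mulrA; apply: ler_pM => //; exact: nrm_ge0.
Qed.

End spline_generators.

(** * Smooth bump functions *)

Section smooth.
Context {R : realType}.
Implicit Types (f g : R -> R) (P Q : {poly R}).

(* The value at x <= 0 is the smooth extension by 0 of [P (1/x) exp (-1/x)]. *)
Definition flat P (x : R) : R := if 0 < x then P.[x^-1] * expR (- x^-1) else 0.

Lemma exprn_le_expR n (y : R) : 0 < y -> y ^+ n <= n`!%:R * expR y.
Proof.
move=> y0; case: n => [|n]; first by rewrite expr0 fact0 mul1r ltW// pexpR_gt1.
rewrite -ler_pdivrMl ?ltr0n ?fact_gt0// mulrC.
by apply: le_trans (expR_ge1Dxn n (ltW y0)); rewrite lerDr.
Qed.

Lemma poly_le_expR P :
  exists2 C : R, 0 <= C & forall y, 0 < y -> `|P.[y]| <= C * expR y.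
Proof.
exists (\sum_(i < size P) `|P`_i| * i`!%:R) => [|y y0].
  by apply: sumr_ge0 => i _; rewrite mulr_ge0.
rewrite horner_coef (le_trans (ler_norm_sum _ _ _))// mulr_suml.
apply: ler_sum => i _; rewrite normrM -mulrA ler_wpM2l//.
by rewrite normrX gtr0_norm// exprn_le_expR.
Qed.

(** The exponential dominates y^2 P(y) at y = 1/x. A quadratic bound is what makes the difference
    quotient at 0 tend to 0. *)
Lemma flat_bound P : exists2 C : R, 0 <= C & forall x, `|flat P x| <= C * x ^+ 2.
Proof.
have [C C0 CP] := poly_le_expR ('X^2 * P); exists C => // x.
rewrite /flat; case: ifPn => [x0|_]; last by rewrite normr0 mulr_ge0// sqr_ge0.
have := CP x^-1; rewrite invr_gt0 => /(_ x0).
rewrite hornerM hornerXn normrM normrX (gtr0_norm (_ : 0 < x^-1)) ?invr_gt0//.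
rewrite normrM (gtr0_norm (expR_gt0 _)) expRN => H.
rewrite ler_pdivrMr ?expR_gt0//.
have x2 : 0 < x ^+ 2 by rewrite exprn_gt0.
rewrite -(ler_pM2l (_ : 0 < x^-1 ^+ 2)) ?exprn_gt0 ?invr_gt0//.
apply: (le_trans H); rewrite le_eqVlt; apply/orP; left; apply/eqP.
by rewrite exprVn; field; rewrite gt_eqF.
Qed.

(** For x > 0 and y = 1/x, the chain rule contributes -y^2 P'(y) from the polynomial and y^2 P(y)
    from the exponential, so the family is closed under differentiation. *)
Lemma is_derive_flat P (x : R) : is_derive x 1 (flat P) (flat ('X^2 * (P - P^`())) x).
Proof.
have [x0|x0|->] := ltgtP x 0.
- rewrite [X in is_derive _ _ _ X](_ : _ = 0); last by rewrite /flat ltNge (ltW x0).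
  apply: (@near_eq_is_derive _ _ _ (cst 0)).
  near=> y; rewrite /flat ifF//; apply/negbTE; rewrite -leNgt ltW//.
  by near: y; exact: lt_nbhsl.
- apply: (@near_eq_is_derive _ _ _ (fun x => (horner P \o GRing.inv) x *
      (expR \o (fun y => - y^-1)) x)).
    near=> y; rewrite /flat ifT//.
    by near: y; exact: lt_nbhsr.
  have xn0 : (id x) != 0 :> R by rewrite gt_eqF.
  have Vd := is_deriveV xn0 (is_derive_id x (1 : R)).
  apply: is_derive_eq.
  rewrite /flat x0 !hornerE /GRing.scale/= exprVn.
  by field.
rewrite [X in is_derive _ _ _ X](_ : _ = 0); last by rewrite /flat ltxx.
have [C C0 CP] := flat_bound P.
have cv : (fun h : R => h^-1 *: (flat P (h + 0) - flat P 0)) @ 0^' --> (0 : R).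
  apply/cvgrPdist_le => /= e e0.
  near=> t; rewrite sub0r normrN /flat ltxx subr0 addr0 -/(flat P t).
  have t0 : t != 0 by near: t; exact: nbhs_dnbhs_neq.
  rewrite normrZ normfV -ler_pdivlMl ?invr_gt0 ?normr_gt0// invrK.
  rewrite (le_trans (CP t))// -real_normK ?num_real// expr2 mulrCA ler_wpM2l//.
  rewrite (@le_trans _ _ ((C + 1) * `|t|))//; first by rewrite ler_wpM2r// lerDl.
  rewrite mulrC -ler_pdivlMr ?ltr_wpDl//.
  near: t; apply: dnbhs0_le; rewrite divr_gt0// ltr_wpDl//.
have dv : derivable (flat P) 0 1.
  apply/cvg_ex; exists 0; apply: cvg_trans cv; apply: near_eq_cvg.
  by near=> t; congr (_ *: (flat P (_ + _) - _)); exact/esym/mulr1.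
split => //; apply/cvg_lim; first exact: Rhausdorff.
apply: cvg_trans cv; apply: near_eq_cvg.
by near=> t; congr (_ *: (flat P (_ + _) - _)); exact/esym/mulr1.
Unshelve. all: by end_near. Qed.

(* A class of functions closed under differentiation, so that all iterated
   derivatives exist. *)
Inductive smooth : (R -> R) -> Prop :=
| smooth_flat P : smooth (flat P)
| smooth_cst c : smooth (cst c)
| smooth_affine f k c : smooth f -> smooth (fun x => f (k * x + c))
| smoothD f g : smooth f -> smooth g -> smooth (fun x => f x + g x)
| smoothM f g : smooth f -> smooth g -> smooth (fun x => f x * g x).

Lemma smooth_is_derive f : smooth f ->
  exists2 g, smooth g & forall x : R, is_derive x 1 f (g x).
Proof.
elim=> {f} [P|c|f k c sf [g sg gP]|f g sf [f' sf' fP] sg [g' sg' gP]|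
  f g sf [f' sf' fP] sg [g' sg' gP]].
- exists (flat ('X^2 * (P - P^`()))); first exact: smooth_flat.
  by move=> x; exact: is_derive_flat.
- by exists (cst 0); [exact: smooth_cst|move=> x; exact: is_derive_cst].
- exists (fun x => cst k x * g (k * x + c)).
    by apply: smoothM; [exact: smooth_cst|exact: smooth_affine].
  move=> x; have lin : is_derive x 1 (fun x => k * x + c) k.
    have := is_deriveD (is_deriveZ k (is_derive_id x (1 : R))) (is_derive_cst c x 1).
    by rewrite addr0 [_ *: _]mulr1.
  have := @is_derive1_comp _ f (fun x => k * x + c) x _ _ (gP _) lin.
  by rewrite mulrC.
- by exists (fun x => f' x + g' x); [exact: smoothD|move=> x; exact: is_deriveD].
- exists (fun x => f x * g' x + g x * f' x).
    by apply: smoothD; exact: smoothM.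
  by move=> x; exact: is_deriveM.
Qed.

Lemma smooth_derive1n f n : smooth f -> smooth (f^`(n))%classic.
Proof.
elim: n => [//|n IH] sf; rewrite derive1nS.
have [g sg gP] := smooth_is_derive (IH sf).
by rewrite (_ : _^`()%classic = g)//; apply/funext => x; rewrite derive1E; case: (gP x).
Qed.

Lemma smooth_derivable f (x : R) : smooth f -> derivable f x 1.
Proof. by move=> /smooth_is_derive[g _ /(_ x)[]]. Qed.

Lemma derivable_continuous f : (forall x : R, derivable f x 1) -> continuous f.
Proof. by move=> df x; apply/differentiable_continuous/derivable1_diffP. Qed.

Lemma smooth_continuous f : smooth f -> continuous f.
Proof. by move=> sf; apply: derivable_continuous => x; exact: smooth_derivable. Qed.

End smooth.

(** * Bumps as test functions *)

Section bump.
Context {R : realType}.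
Implicit Types (f g phi : R -> R).

(* Converges pointwise to the indicator of ]c, d[ as n grows. *)
Definition bump (c d : R) (n : nat) (x : R) : R :=
  flat 1 (n.+1%:R * (x - c)) * flat 1 (n.+1%:R * (d - x)).

Lemma smooth_bump c d n : smooth (bump c d n).
Proof.
apply: smoothM.
  have := smooth_affine n.+1%:R (- n.+1%:R * c) (smooth_flat (1 : {poly R})).
  by congr smooth; apply/funext => x; congr (flat 1 _); ring.
have := smooth_affine (- n.+1%:R) (n.+1%:R * d) (smooth_flat (1 : {poly R})).
by congr smooth; apply/funext => x; congr (flat 1 _); ring.
Qed.

Lemma flat1E (x : R) : flat 1 x = if 0 < x then expR (- x^-1) else 0.
Proof. by rewrite /flat hornerC mul1r. Qed.

Lemma flat1_itv (x : R) : 0 <= flat 1 x <= 1.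
Proof.
rewrite flat1E; case: ifPn => [x0|_]; last by rewrite lexx ler01.
by rewrite expR_ge0 expR_le1 oppr_le0 invr_ge0 ltW.
Qed.

Lemma norm_bump_le1 c d n x : `|bump c d n x| <= 1.
Proof.
have /andP[? ?] := flat1_itv (n.+1%:R * (x - c)).
have /andP[? ?] := flat1_itv (n.+1%:R * (d - x)).
by rewrite ger0_norm ?mulr_ge0// mulr_ile1.
Qed.

Lemma bump_neq0 c d n x : bump c d n x != 0 -> c <= x <= d.
Proof.
rewrite /bump !flat1E; case: ifPn; last by rewrite mul0r eqxx.
rewrite pmulr_rgt0// subr_gt0 => /ltW ->.
case: ifPn; last by rewrite mulr0 eqxx.
by rewrite pmulr_rgt0// subr_gt0 => /ltW ->.
Qed.

Lemma cvg_flat1 (y : R) :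
  flat 1 (n.+1%:R * y) @[n --> \oo] --> ((0 < y)%R%:R : R).
Proof.
have [y0|y0] := ltP 0 y; last first.
  apply: cvg_near_cst; apply: nearW => n.
  by rewrite flat1E ltNge mulr_ge0_le0.
rewrite (_ : (fun n => _) = (fun n => expR (- (y^-1 * harmonic n)))); last first.
  apply/funext => n; rewrite flat1E pmulr_rgt0// y0 /harmonic.
  by rewrite invfM mulrC.
rewrite -[X in _ --> X](expR0 R) -[X in expR X]oppr0 -(mulr0 y^-1).
apply: continuous_cvg; first exact: continuous_expR.
by apply: cvgN; apply: cvgMr; exact: cvg_harmonic.
Qed.

Lemma cvg_bump c d x : bump c d n x @[n --> \oo] --> (\1_(`]c, d[%classic : set R) x : R).
Proof.
have -> : \1_(`]c, d[%classic : set R) x = (0 < x - c)%R%:R * (0 < d - x)%R%:R :> R.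
  by rewrite indicE mem_setE/= in_itv/= !subr_gt0 -natrM mulnb.
by apply: cvgM; exact: cvg_flat1.
Qed.

Variables (a b : R).
Hypothesis ab : a < b.
Local Notation mu := (@lebesgue_measure R).
Local Notation D := (`]a, b[%classic : set (measurableTypeR R)).
Let mD : measurable D. Proof. exact: measurable_itv. Qed.

Lemma supported_test_function phi c d :
  (forall (n : nat) (x : R), derivable (phi^`(n))%classic x 1) ->
  (forall x, phi x != 0 -> c <= x <= d) -> a < c -> d < b ->
  test_function a b phi.
Proof.
move=> dphi supp ac db.
have sub : closure [set x | phi x != 0] `<=` `[c, d]%classic.
  rewrite closureE; apply: smallest_sub; first exact: interval_closed.
  by move=> x /= /supp; rewrite in_itv.
split => //.
  apply: subclosed_compact sub; first exact: closed_closure.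
  exact: segment_compact.
apply: (subset_trans sub) => x /=; rewrite !in_itv/= => /andP[cx xd].
by rewrite (lt_le_trans ac cx) (le_lt_trans xd db).
Qed.

Lemma test_function_bump c d n : a < c -> d < b -> test_function a b (bump c d n).
Proof.
apply: supported_test_function; last exact: bump_neq0.
by move=> k x; apply/smooth_derivable/smooth_derive1n/smooth_bump.
Qed.

(** Off its closed support phi vanishes on a neighbourhood, so the support cannot grow under
    differentiation. *)
Lemma test_function_derive1 phi :
  test_function a b phi -> test_function a b (phi^`())%classic.
Proof.
move=> [dphi cphi sphi].
have sub : closure [set x | (phi^`())%classic x != 0] `<=` closure [set x | phi x != 0].
  rewrite [X in X `<=` _]closureE; apply: smallest_sub; first exact: closed_closure.
  move=> x /=; apply: contra_neqP => nx; rewrite derive1E.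
  rewrite (@near_eq_derive _ _ _ _ (cst 0)) ?derive_cst//.
  have : nbhs x (~` closure [set x | phi x != 0]).
    by apply: open_nbhs_nbhs; split => //; exact/closed_openC/closed_closure.
  apply: filterS => y /= ny; apply/eqP/negPn; apply: contra_notN ny.
  by move=> ?; apply: subset_closure.
split.
- by move=> n x; rewrite -derive1Sn.
- by apply: subclosed_compact sub => //; exact: closed_closure.
- exact: subset_trans sphi.
Qed.

Lemma test_function_derive1n phi n :
  test_function a b phi -> test_function a b (phi^`(n))%classic.
Proof. by elim: n => [//|n IH] /IH/test_function_derive1; rewrite -derive1nS. Qed.

Lemma test_function_continuous phi : test_function a b phi -> continuous phi.
Proof. by move=> [dphi _ _]; apply: derivable_continuous; exact: (dphi 0%N). Qed.

Lemma test_function_out phi x : test_function a b phi -> ~ D x -> phi x = 0.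
Proof.
move=> [_ _ sphi] nD; apply/eqP/negPn; apply: contra_notN nD => px.
by apply/sphi/subset_closure.
Qed.

Lemma sq_continuous f : continuous f -> sq a b f.
Proof.
move=> cf; split; first by apply/measurable_funTS; apply: continuous_measurable_fun.
have fi : mu.-integrable `[a, b] (EFin \o (fun x => f x ^+ 2)).
  apply: continuous_compact_integrable; first exact: segment_compact.
  by apply: continuous_subspaceT => x; apply: cvgM; exact: cf.
by apply: integrableS fi => //; exact: subset_itv_oo_cc.
Qed.

Lemma sq_test_function phi : test_function a b phi -> sq a b phi.
Proof. by move=> /test_function_continuous/sq_continuous. Qed.

Lemma primitive_derive1 (F : R -> R) x : a < x ->
  (forall x, derivable F x 1) -> continuous (F^`())%classic ->
  primitive a (F^`())%classic x = F x - F a.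
Proof.
move=> ax dF cF.
have cF' := derivable_continuous dF.
have fi : mu.-integrable `[a, x] (EFin \o (F^`())%classic).
  apply: continuous_compact_integrable; first exact: segment_compact.
  exact: continuous_subspaceT.
rewrite /primitive Rintegral_itv_obnd_cbnd; last first.
  by apply: integrableS fi => //; exact: subset_itv_oo_cc.
rewrite Rintegral_itv_bndo_bndc; last first.
  by apply: integrableS fi => //; exact: subset_itv_co_cc.
have LR : derivable_oo_LRcontinuous F a x.
  split; first by move=> z _; exact: dF.
  - by apply: cvg_at_right_filter; exact: cF'.
  - by apply: cvg_at_left_filter; exact: cF'.
have cF0 : {within `[a, x], continuous (F^`())%classic} by exact: continuous_subspaceT.
have FF' : {in `]a, x[, (F^`())%classic =1 (F^`())%classic} by [].
by rewrite /Rintegral (continuous_FTC2 ax cF0 LR FF').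
Qed.

Lemma primitive_test_function phi x : test_function a b phi -> a < x ->
  primitive a (phi^`())%classic x = phi x.
Proof.
move=> tphi ax; rewrite primitive_derive1//.
- by rewrite (@test_function_out _ a)// ?subr0//= in_itv/= ltxx.
- by have [dphi _ _] := tphi; exact: (dphi 0%N).
- exact/test_function_continuous/test_function_derive1.
Qed.

Lemma integral_derive1_test_function phi : test_function a b phi ->
  \int[mu]_(t in D) (phi^`())%classic t = 0.
Proof.
move=> tphi; rewrite -[LHS]/(primitive a _ b) primitive_test_function//.
by rewrite (@test_function_out _ b)//= in_itv/= ltxx andbF.
Qed.

End bump.

(** * Weak derivatives *)

Section weak_derivatives.
Context {R : realType}.
Variables (a b : R).
Hypothesis ab : a < b.
Local Notation mu := (@lebesgue_measure R).
Local Notation D := (`]a, b[%classic : set (measurableTypeR R)).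
Implicit Types (e f g u v w phi : R -> R).
Let mD : measurable D. Proof. exact: measurable_itv. Qed.

(** The bumps are bounded by 1 and tend to the indicator of []c, d[]: dominated convergence with
    majorant |f|. *)
Lemma itv_integral_eq0 f c d : sq a b f ->
  (forall n, ip a b f (bump c d n) = 0) -> a < c -> d < b ->
  \int[mu]_(x in `]c, d[) f x = 0.
Proof.
move=> sf f0 ac db; have fi := sq_itg sf.
have sb n : sq a b (bump c d n).
  by apply/sq_test_function/test_function_bump.
have cvgE : (\int[mu]_(x in D) (f x * bump c d n x)%:E @[n --> \oo] -->
    \int[mu]_(x in D) (f x * \1_(`]c, d[%classic : set R) x)%:E)%E.
  apply: (@dominated_cvg _ _ _ _ _ mD _ _ (fun x => `|f x|%:E)) => //.
  - by move=> n; apply/measurable_EFinP; apply: measurable_funM; [exact: sf.1|exact: (sb n).1].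
  - move=> x _; apply: cvg_EFin; first exact: nearW.
    by apply: cvgMr; exact: cvg_bump.
  - by apply: integrable_norm.
  - move=> n x _; rewrite /= lee_fin normrM -[leRHS]mulr1 ler_wpM2l//.
    exact: norm_bump_le1.
have E0 n : (\int[mu]_(x in D) (f x * bump c d n x)%:E = 0)%E.
  rewrite -[LHS]fineK; first by congr EFin; exact: f0.
  by apply: integrable_fin_num => //; exact: itgM.
have : (\int[mu]_(x in D) (f x * \1_(`]c, d[%classic : set R) x)%:E = 0)%E.
  rewrite -(cvg_lim (@ereal_hausdorff R) cvgE) (_ : (fun n => _) = cst 0%E).
    exact: (lim_cst (@ereal_hausdorff R)).
  exact/funext.
rewrite /Rintegral => E; rewrite (_ : integral _ _ _ = 0%E)// -E.
rewrite -[X in integral _ X _](_ : D `&` `]c, d[%classic = _); last first.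
  apply/setIidr; apply: subset_itv; rewrite bnd_simp; exact: ltW.
rewrite integral_mkcondr; apply: eq_integral => x _.
by rewrite patchE indicE; case: ifP; rewrite ?mulr1 ?mulr0.
Qed.

(* The primitive of f vanishes identically, and its derivative is f at every
   Lebesgue point. *)
Lemma fundamental_lemma f g : sq a b f -> sq a b g ->
  (forall c d n, a < c -> d < b -> ip a b f (bump c d n) = 0) ->
  ip a b f g = 0.
Proof.
move=> sf sg f0.
have Z c d : a < c -> d < b -> \int[mu]_(x in `]c, d[) f x = 0.
  by move=> ac db; apply: itv_integral_eq0 => // n; exact: f0.
have fi := sq_itg sf.
have fiT : mu.-integrable setT (EFin \o (f \_ D)).
  by rewrite -restrict_EFin; exact/(integrable_mkcond _ mD).1.
have lf : locally_integrable [set: R] (f \_ D).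
  exact: integrable_locally fi.
have ae0 : ae_eq mu D (EFin \o (fun x => f x * g x)) (cst 0%E).
  have := lebesgue_differentiation lf.
  apply: filterS => [|x lx Dx]; first exact: (ae_filter_ringOfSetsType mu).
  have /andP[ax xb] : a < x < b by move: Dx; rewrite /= in_itv.
  pose c := (a + x) / 2; pose d := (x + b) / 2.
  have ac : a < c by rewrite midf_lt.
  have cx : c < x by rewrite midf_lt.
  have xd : x < d by rewrite midf_lt.
  have db : d < b by rewrite midf_lt.
  have fcd : mu.-integrable [set` Interval (BRight c) (BRight d)] (EFin \o (f \_ D)).
    exact: integrableS fiT.
  have [_] := FTC1_lebesgue_pt xd fcd cx lx.
  rewrite derive1E (@near_eq_derive _ _ _ _ (cst 0)) ?derive_cst; last first.
    near=> y.
    have cy : c < y by near: y; exact: lt_nbhsr.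
    have yd : y < d by near: y; exact: lt_nbhsl.
    rewrite -Rintegral_itv_bndo_bndc; last first.
      exact: integrableS fiT.
    rewrite -[RHS](Z c y ac (lt_trans yd db)); apply: eq_Rintegral => z.
    rewrite inE/= in_itv/= => /andP[cz zy]; rewrite patchE mem_setE/= in_itv/=.
    by rewrite (lt_trans ac cz) (lt_trans zy (lt_trans yd db)).
  rewrite patchE mem_set// => fx0.
  by rewrite /= -fx0 mul0r.
rewrite /ip /Rintegral (ae_eq_integral (cst 0%E))// ?integral0//.
by apply/measurable_EFinP/measurable_funM; [exact: sf.1|exact: sg.1].
Unshelve. all: by end_near. Qed.

(** No bump integral is computed: if all were 0, [fundamental_lemma] would give b - a = <1, 1> = 0.
    The bump found here is the normalizing function for du Bois-Reymond. *)
Lemma exists_bump_neq0 : exists c d n,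
  [/\ a < c, d < b & ip a b (bump c d n) (cst 1) != 0].
Proof.
apply: contrapT => H.
have : ip a b (cst 1) (cst 1) = 0.
  apply: fundamental_lemma; [exact: sq_cst|exact: sq_cst|].
  move=> c d n ac db; apply/eqP/negPn/negP => nz; apply: H.
  by exists c, d, n; rewrite ipC.
rewrite /ip (_ : (fun _ => _) = cst 1); last by apply/funext => x; rewrite mulr1.
rewrite Rintegral_cst//= mul1r lebesgue_measure_itv/= lte_fin ab/= => /eqP.
by rewrite subr_eq0 gt_eqF.
Qed.

(** The primitive of rho vanishes to the left of c trivially, and to the right of d because the
    total integral is 0. *)
Lemma smooth_primitive_test_function rho c d : smooth rho ->
  (forall x, rho x != 0 -> c <= x <= d) -> a < c -> d < b ->
  \int[mu]_(x in D) rho x = 0 ->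
  exists2 phi, test_function a b phi & (phi^`())%classic = rho.
Proof.
move=> srho supp ac db rho0.
have crho := smooth_continuous srho.
have out x : ~~ (c <= x <= d) -> rho x = 0.
  by move=> nx; apply/eqP/negPn; apply: contra nx; exact: supp.
have rhoi : mu.-integrable setT (EFin \o rho).
  have := @continuous_compact_integrable _ rho `[c, d]%classic (@segment_compact _ _ _).
  have mcd : measurable (`[c, d]%classic : set (measurableTypeR R)).
    exact: measurable_itv.
  move=> /(_ (continuous_subspaceT crho)) /(integrable_mkcond _ mcd).1.
  apply: eq_integrable => // x _; rewrite patchE mem_setE/= in_itv/=.
  by case: ifPn => // /out ->.
(* Starting at -oo lets the fundamental theorem apply at every real point, with no special case at
   a. *)
pose phi x := \int[mu]_(t in `]-oo, x]) rho t.
have phiP x : derivable phi x 1 /\ (phi^`())%classic x = rho x.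
  apply: (@continuous_FTC1 _ rho -oo%O x (x + 1)) => //.
  - by rewrite ltrDl.
  - exact: integrableS rhoi.
  - exact: ltNyr.
  - exact: crho.
have dphi : (phi^`())%classic = rho by apply/funext => x; have [] := phiP x.
have full (A : set R) : `[c, d] `<=` A ->
    \int[mu]_(t in A) rho t = \int[mu]_t rho t.
  move=> cdA; rewrite Rintegral_mkcond; apply: eq_Rintegral => t _.
  rewrite patchE; case: ifPn => // tA; apply/esym/out; apply: contra tA => cd.
  by rewrite inE; apply: cdA; rewrite /= in_itv.
have phi_lt x : x < c -> phi x = 0.
  move=> xc; rewrite /phi (@eq_Rintegral _ _ _ _ _ (cst 0)); last first.
    move=> t; rewrite inE/= in_itv/= => tx; apply/out.
    by rewrite negb_and -ltNge (le_lt_trans tx).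
  by rewrite Rintegral_cst ?mul0r//; exact: measurable_itv.
have phi_gt x : d < x -> phi x = 0.
  move=> dx; rewrite /phi full; last first.
    by move=> t /=; rewrite !in_itv/= => /andP[_ /le_trans]; apply; exact: ltW.
  rewrite -rho0 full// => t /=; rewrite !in_itv/= => /andP[ct td].
  by rewrite (lt_le_trans ac ct) (le_lt_trans td db).
exists phi => //; apply: (@supported_test_function _ a b _ c d) => //.
  move=> [|n] x; first by have [] := phiP x.
  by rewrite derive1Sn dphi; exact/smooth_derivable/smooth_derive1n.
move=> x; apply: contraR; rewrite negb_and -!ltNge => /orP[/phi_lt|/phi_gt] ->//.
Qed.

(* By the du Bois-Reymond argument w differs from [primitive a w'] by a constant,
   to which e is orthogonal. *)
Lemma weak_derivative1_primitive e w w' : sq a b w -> sq a b w' ->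
  is_weak_derivative a b 1 w w' ->
  sq a b e -> \int[mu]_(t in D) e t = 0 ->
  ip a b e w = - ip a b (primitive a e) w'.
Proof.
move=> sw sw' ww' se e0.
have sKw' := sq_primitive (sq_itg sw'); have sKe := sq_primitive (sq_itg se).
pose f := w \- primitive a w'.
have sf : sq a b f by exact: sqB.
have fphi phi : test_function a b phi -> ip a b f (phi^`())%classic = 0.
  move=> tphi; have tphi' := test_function_derive1 tphi.
  have sphi := sq_test_function tphi; have sphi' := sq_test_function tphi'.
  rewrite /f ipBl//.
  have -> : ip a b w (phi^`())%classic = - ip a b w' phi.
    by have := ww' _ tphi; rewrite expr1 mulN1r.
  have := integration_by_parts_primitive sw' sphi'.
  rewrite (integral_derive1_test_function ab tphi) mulr0 => /eqP.
  rewrite addr_eq0 => /eqP ->; rewrite opprK addrC; apply/eqP; rewrite subr_eq0; apply/eqP.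
  apply: eq_Rintegral => x; rewrite inE/= in_itv/= => /andP[ax _].
  by rewrite (@primitive_test_function _ a b).
have [c0 [d0 [n0 [ac0 db0 th0]]]] := exists_bump_neq0.
pose th := bump c0 d0 n0.
have sth : sq a b th by apply/sq_test_function/test_function_bump.
have s1 c : sq a b (cst c) by exact: sq_cst.
(* The only candidate for the constant value of f, since f - k has to be orthogonal to [th]. *)
pose k := ip a b f th / ip a b th (cst 1).
have fk : ip a b (f \- cst k) e = 0.
  apply: fundamental_lemma => //; first exact: sqB.
  move=> c d n ac db; pose psi := bump c d n.
  have spsi : sq a b psi by apply/sq_test_function/test_function_bump.
  (* Subtracting m [th] from the arbitrary bump [psi] leaves mean zero; the difference is thus the
     derivative of a test function, to which f is orthogonal by [fphi]. *)
  pose m := ip a b psi (cst 1) / ip a b th (cst 1).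
  pose rho x := psi x + cst (- m) x * th x.
  have sth' : sq a b (fun x => - m * th x) by exact: sqZ.
  have rhoE g : sq a b g -> ip a b rho g = ip a b psi g - m * ip a b th g.
    by move=> sg; rewrite ipDl// ipZl// mulNr.
  have [] := @smooth_primitive_test_function rho (Num.min c c0) (Num.max d d0).
  - apply: smoothD; first exact: smooth_bump.
    by apply: smoothM; [exact: smooth_cst|exact: smooth_bump].
  - move=> x; rewrite ge_min le_max; apply: contraR.
    rewrite negb_and !negb_or -!ltNge => H.
    have -> : rho x = 0; last by [].
    rewrite /rho; have /eqP-> : psi x == 0.
      apply: contraTT H => /bump_neq0 /andP[cx xd].
      by rewrite !ltNge cx xd.
    have /eqP-> : th x == 0.
      apply: contraTT H => /bump_neq0 /andP[cx xd].
      by rewrite !ltNge cx xd !andbF.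
    by rewrite mulr0 addr0.
  - by rewrite lt_min ac ac0.
  - by rewrite gt_max db db0.
  - have := rhoE _ (s1 1); rewrite /m divfK// subrr => <-.
    by apply: eq_Rintegral => x _; rewrite mulr1.
  move=> phi tphi phiE; have := fphi _ tphi; rewrite phiE ipC rhoE// => H.
  rewrite ipBl// -/psi (ipC _ _ f) (ipC _ _ (cst k)).
  have -> : ip a b psi (cst k) = k * ip a b psi (cst 1).
    rewrite ipC (ipC _ _ psi) -ipZl//.
    by apply: eq_ip => x _ /=; rewrite mulr1.
  move: H; rewrite /m /k (ipC _ _ th f) => H.
  by rewrite -[RHS]H; ring.
have ek : ip a b (cst k) e = 0.
  have -> : ip a b (cst k) e = k * \int[mu]_(t in D) e t; last by rewrite e0 mulr0.
  by rewrite -RintegralZl//; exact: sq_itg.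
move: fk; rewrite ipBl// ek subr0 /f ipBl// => /eqP; rewrite subr_eq0 => /eqP H.
rewrite ipC H; apply/eqP; rewrite -addr_eq0 ipC.
by rewrite addrC integration_by_parts_primitive// e0 mul0r.
Qed.

Lemma is_weak_derivative0 u : is_weak_derivative a b 0 u u.
Proof. by move=> phi _; rewrite expr0 mul1r. Qed.

Lemma is_weak_derivativeB k u1 u2 v1 v2 :
  sq a b u1 -> sq a b u2 -> sq a b v1 -> sq a b v2 ->
  is_weak_derivative a b k u1 v1 -> is_weak_derivative a b k u2 v2 ->
  is_weak_derivative a b k (u1 \- u2) (v1 \- v2).
Proof.
move=> su1 su2 sv1 sv2 d1 d2 phi tphi.
have sphi := sq_test_function tphi.
have sphik := sq_test_function (test_function_derive1n k tphi).
rewrite -!/(ip a b (_ \- _) _) !ipBl// mulrBr.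
by congr (_ - _); [exact: d1|exact: d2].
Qed.

Lemma is_weak_derivative_lin k u1 u2 v1 v2 c :
  sq a b u1 -> sq a b u2 -> sq a b v1 -> sq a b v2 ->
  is_weak_derivative a b k u1 v1 -> is_weak_derivative a b k u2 v2 ->
  is_weak_derivative a b k (fun x => u1 x + c * u2 x) (fun x => v1 x + c * v2 x).
Proof.
move=> su1 su2 sv1 sv2 d1 d2 phi tphi.
have sphi := sq_test_function tphi.
have sphik := sq_test_function (test_function_derive1n k tphi).
rewrite -[LHS]/(ip a b (u1 \+ (fun x => c * u2 x)) _).
rewrite -[X in _ = _ * X]/(ip a b (v1 \+ (fun x => c * v2 x)) _).
rewrite !ipDl//; try exact: sqZ.
rewrite !ipZl// mulrDr mulrCA.
by congr (_ + _ * _); [exact: d1|exact: d2].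
Qed.

(** The derivative of a test function is again one, so the identity of order k tested with phi'
    meets the one of order k + 1 tested with phi. *)
Lemma is_weak_derivative_step k u w w' :
  is_weak_derivative a b k u w -> is_weak_derivative a b k.+1 u w' ->
  is_weak_derivative a b 1 w w'.
Proof.
move=> d1 d2 phi tphi; have := d1 _ (test_function_derive1 tphi).
rewrite -derive1Sn (d2 _ tphi) exprS -mulrA mulrCA expr1 => /(mulrI _) H.
by rewrite -H// unitrX// unitrN1.
Qed.

Lemma is_weak_derivative_primitive k g v :
  sq a b g -> sq a b v -> is_weak_derivative a b k g v ->
  is_weak_derivative a b k.+1 (primitive a g) v.
Proof.
move=> sg sv gv phi tphi.
have tchi := test_function_derive1n k tphi.
have schi' := sq_test_function (test_function_derive1 tchi).
have := integration_by_parts_primitive sg schi'.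
rewrite (integral_derive1_test_function ab tchi) mulr0 -derive1nS => /eqP.
rewrite addr_eq0 => /eqP; rewrite {1}/ip => ->.
rewrite exprS -mulrA -(gv _ tphi) mulN1r; congr (- _).
apply: eq_Rintegral => x; rewrite inE/= in_itv/= => /andP[ax _].
by rewrite (@primitive_test_function _ a b).
Qed.

Lemma is_weak_derivative_cst k c : is_weak_derivative a b k.+1 (cst c) (cst 0).
Proof.
move=> phi tphi.
have tchi := test_function_derive1n k tphi.
have schi' := sq_test_function (test_function_derive1 tchi).
rewrite derive1nS RintegralZl//; last exact: sq_itg.
rewrite (integral_derive1_test_function ab tchi) mulr0.
by rewrite -[X in _ * X]/(ip a b (fun _ => 0) phi) ip0l mulr0.
Qed.

(** The difference v - v' is orthogonal to every bump, hence to v and to v'. Equality of norms is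
    what makes the seminorm independent of the representative chosen by [xget]. *)
Lemma weak_derivative_unique k u v v' : sq a b v -> sq a b v' ->
  is_weak_derivative a b k u v -> is_weak_derivative a b k u v' ->
  nrm a b v = nrm a b v'.
Proof.
move=> sv sv' d1 d2; rewrite /nrm; congr Num.sqrt.
have sd : sq a b (v \- v') by exact: sqB.
have vv' g : sq a b g -> ip a b v g = ip a b v' g.
  move=> sg; apply/eqP; rewrite -subr_eq0 -ipBl//; apply/eqP.
  apply: fundamental_lemma => // c d n ac db.
  have tb := test_function_bump n ac db; have sb := sq_test_function tb.
  rewrite ipBl//; apply/eqP; rewrite subr_eq0; apply/eqP.
  have := d1 _ tb; rewrite (d2 _ tb) => /(mulrI _) H.
  by rewrite /ip H// unitrX// unitrN1.
by rewrite vv'// ipC vv'.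
Qed.

Lemma sobolev_weak_derivatives r u : sobolev a b r u -> exists w : nat -> R -> R,
  forall k, (k <= r)%N -> sq a b (w k) /\ is_weak_derivative a b k u (w k).
Proof.
move=> [_ uP].
have /choice[w wP] k : exists v, (k <= r)%N -> sq a b v /\ is_weak_derivative a b k u v.
  have [/uP[v [/L2P sv dv]]|rk] := leqP k r; first by exists v.
  by exists u.
by exists w.
Qed.

Lemma sobolev_seminormE k u v : sq a b v -> is_weak_derivative a b k u v ->
  sobolev_seminorm a b k u = nrm a b v.
Proof.
move=> sv uv; rewrite /sobolev_seminorm L2_normE /weak_derivative.
case: xgetP => [w _ [/L2P sw uw]|/(_ v)[]]; last by split => //; exact/L2P.
exact: weak_derivative_unique uw uv.
Qed.

End weak_derivatives.

(** * Sobolev regularity of splines *)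

Section sobolev.
Context {R : realType}.
Variables (a b : R).
Hypothesis ab : a < b.
Implicit Types (u s : R -> R).

Lemma sobolevS r r' u : (r' <= r)%N -> sobolev a b r u -> sobolev a b r' u.
Proof. by move=> rr' [Lu uP]; split => // k kr; apply: uP; exact: leq_trans rr'. Qed.

Lemma sobolev_sq r u : sobolev a b r u -> sq a b u.
Proof. by move=> [/L2P]. Qed.

Lemma sobolev_lin r u1 u2 c : sobolev a b r u1 -> sobolev a b r u2 ->
  sobolev a b r (fun x => u1 x + c * u2 x).
Proof.
move=> [/L2P s1 P1] [/L2P s2 P2]; split; first exact/L2P/(sqD s1 (sqZ c s2)).
move=> k kr; have [v1 [/L2P sv1 d1]] := P1 k kr; have [v2 [/L2P sv2 d2]] := P2 k kr.
exists (fun x => v1 x + c * v2 x); split; first exact/L2P/(sqD sv1 (sqZ c sv2)).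
exact: is_weak_derivative_lin.
Qed.

Lemma sobolevB r u1 u2 : sobolev a b r u1 -> sobolev a b r u2 ->
  sobolev a b r (u1 \- u2).
Proof.
move=> s1 s2; have := sobolev_lin (-1) s1 s2.
by congr sobolev; apply/funext => x /=; rewrite mulN1r.
Qed.

Lemma sobolev_cst r c : sobolev a b r (cst c).
Proof.
split; first exact/L2P/sq_cst.
move=> [|k] kr; first by exists (cst c); split; [exact/L2P/sq_cst|exact: is_weak_derivative0].
by exists (cst 0); split; [exact/L2P/sq_cst|exact: is_weak_derivative_cst].
Qed.

Lemma sobolev_primitive r u : sobolev a b r u -> sobolev a b r.+1 (primitive a u).
Proof.
move=> [/L2P su uP]; have sK := sq_primitive (sq_itg su).
split; first exact/L2P.
move=> [|k] kr; first by exists (primitive a u); split; [exact/L2P|exact: is_weak_derivative0].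
have [v [/L2P sv uv]] := uP k kr.
by exists v; split; [exact/L2P|exact: is_weak_derivative_primitive].
Qed.

End sobolev.

Lemma poly_primitive_exists (R : realType) m (P : {poly R}) : (size P <= m)%N ->
  exists Q : {poly R}, (size Q <= m.+1)%N /\ (Q^`())%R = P.
Proof.
(* At i = 0 the division by zero yields the constant term 0. *)
move=> Pm; exists (\poly_(i < m.+1) (P`_i.-1 / i%:R)); split; first exact: size_poly.
apply/polyP => i; rewrite coef_deriv coef_poly ltnS.
case: ltnP => [im|mi]; last by rewrite mul0rn nth_default// (leq_trans Pm).
by rewrite -[LHS]mulr_natr divfK// pnatr_eq0.
Qed.

(** * Membership of iterated primitives in the spline space *)

Section splines.
Context {R : realType}.
Variables (a h : R) (n : nat).
Hypotheses (h0 : 0 < h) (n0 : (0 < n)%N).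
Local Notation b := (a + h * n%:R).
Implicit Types (g s : R -> R).

Let ab : a < b.
Proof. by rewrite ltrDl mulr_gt0// ltr0n. Qed.

Definition piecewise_poly m s := forall j, (j < n)%N ->
  exists P : {poly R}, (size P <= m.+1)%N /\ forall x, cell a h j x -> s x = P.[x].

Let knot_inj x i j : cell a h i x -> cell a h j x -> i = j.
Proof.
rewrite /cell /= !in_itv/= => /andP[ix xi] /andP[jx xj].
have := lt_le_trans ix xj; rewrite ltrD2l ltr_pM2l// ltr_nat ltnS => ij.
have := lt_le_trans jx xi; rewrite ltrD2l ltr_pM2l// ltr_nat ltnS => ji.
by apply/eqP; rewrite eqn_leq ij ji.
Qed.

Lemma piecewise_poly_lin m s1 s2 c : piecewise_poly m s1 -> piecewise_poly m s2 ->
  piecewise_poly m (fun x => s1 x + c * s2 x).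
Proof.
move=> H1 H2 j jn; have [P1 [z1 E1]] := H1 j jn; have [P2 [z2 E2]] := H2 j jn.
exists (P1 + c *: P2); split; last by move=> x xj; rewrite E1// E2// !hornerE.
rewrite (leq_trans (size_polyD _ _))// geq_max z1.
exact: leq_trans (size_scale_leq _ _) z2.
Qed.

Lemma piecewise_poly_cst m c : piecewise_poly m (cst c).
Proof.
move=> j _; exists c%:P; split; last by move=> x _; rewrite hornerC.
exact: leq_trans (size_polyC_leq1 _) _.
Qed.

Lemma piecewise_poly_primitive m g : itg a b g -> piecewise_poly m g ->
  piecewise_poly m.+1 (primitive a g).
Proof.
move=> gi gP j jn; have [P [zP gE]] := gP j jn.
have [Q [zQ QP]] := poly_primitive_exists zP.
pose k := a + h * j%:R.
(* The added constant adjusts the antiderivative Q to the value of the primitive at the left knot of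
   the cell. *)
exists (Q + (primitive a g k - Q.[k])%:P); split.
  by rewrite (leq_trans (size_polyD _ _))// geq_max zQ (leq_trans (size_polyC_leq1 _)).
move=> x; rewrite /cell /= in_itv/= => /andP[kx xk].
have xb : x <= b by rewrite (le_trans xk)// lerD2l ler_pM2l// ler_nat.
have ak : a <= k by rewrite lerDl mulr_ge0// ltW.
rewrite (primitive_itvD gi ak (ltW kx) xb) !hornerE.
have -> : \int[lebesgue_measure]_(t in `]k, x[) g t = primitive k (horner Q)^`()%classic x.
  apply: eq_Rintegral => t; rewrite inE/= in_itv/= => /andP[kt tx].
  by rewrite -derivE QP gE// /cell /= in_itv/= kt (le_trans (ltW tx)).
rewrite primitive_derive1//.
- by rewrite addrCA addrA.
- by rewrite -derivE; exact: continuous_horner.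
Qed.

Lemma spline_gens_piecewise_poly m : {in spline_gens a h n m, forall g, piecewise_poly m g}.
Proof.
elim: m => [|m IH] g; rewrite inE => /predU1P[->|]; try exact: piecewise_poly_cst.
  move=> /mapP[i _ ->] j jn; exists ((i == j)%:R)%:P; split.
    exact: size_polyC_leq1.
  move=> x xj; rewrite hornerC indicE; congr _%:R; congr nat_of_bool.
  apply/idP/eqP => [|->]; last by rewrite inE.
  by rewrite inE => xi; exact: knot_inj xi xj.
move=> /mapP[f fG ->]; apply: piecewise_poly_primitive; last exact: IH.
exact/sq_itg/(sq_spline_gens fG).
Qed.

Lemma spline_gens_sobolev m : {in spline_gens a h n m, forall g, sobolev a b m g}.
Proof.
elim: m => [|m IH] g gG.
  have sg := sq_spline_gens gG; split; first exact/L2P.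
  move=> k; rewrite leqn0 => /eqP->; exists g.
  by split; [exact/L2P|exact: is_weak_derivative0].
move: gG; rewrite inE => /predU1P[->|]; first exact: sobolev_cst.
by move=> /mapP[f fG ->]; apply: sobolev_primitive => //; exact: IH.
Qed.

Lemma lspan_spline_gens m s : lspan (spline_gens a h n m) s ->
  piecewise_poly m s /\ sobolev a b m s.
Proof.
elim=> [|{}s c g _ [IHp IHs] gG].
  by split; [exact: (piecewise_poly_cst m 0)|exact: (sobolev_cst ab m 0)].
split; first by apply: piecewise_poly_lin => //; exact: spline_gens_piecewise_poly.
by apply: sobolev_lin => //; exact: spline_gens_sobolev.
Qed.

Lemma iter_primitive_spline m r s : lspan (spline_gens a h n m) s ->
  [/\ piecewise_poly (r + m) (iter r (primitive a) s),
      sobolev a b (r + m) (iter r (primitive a) s) &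
      is_weak_derivative a b r (iter r (primitive a) s) s].
Proof.
move=> /lspan_spline_gens[pps sobs].
elim: r => [|r [IHp IHs IHd]]; first by split => //; exact: is_weak_derivative0.
have sr := sobolev_sq IHs.
split.
- by apply: piecewise_poly_primitive => //; exact: sq_itg.
- exact: sobolev_primitive.
- by apply: is_weak_derivative_primitive => //; exact: sobolev_sq sobs.
Qed.

Lemma piecewise_poly_spline_space p s : sobolev a b p s -> piecewise_poly p s ->
  spline_space a b p h s.
Proof.
move=> sobs pps; split => // j; rewrite addrC addKr mulKf ?gt_eqF// ltr_nat => jn.
have [P [zP sE]] := pps j jn.
by exists P; split => // x xj; apply: sE.
Qed.

End splines.

Theorem theorem7 (R : realType) (a b : R) (hab : a < b) (h : R)
    (hh : grid_size a b h) (q p r : nat) (hp : (0 < p)%N)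
    (hrq : (r <= q)%N) (hqp : (q <= p.+1)%N)
    (hpr : h * (p%:R - r%:R) < b - a)
    (u : R -> R) (hu : sobolev a b q u) :
  exists uph : R -> R,
    [/\ spline_space a b p h uph,
        sobolev a b r (u \- uph) &
        sobolev_seminorm a b r (u \- uph) <=
          (Num.sqrt 2 * h) ^+ (q - r) * sobolev_seminorm a b q u].
Proof.
have [h0 [n [n0 hn]]] := hh.
have bE : b = a + h * n%:R by rewrite -hn mulVKf ?gt_eqF// subrKC.
subst b.
(* The case r = q allows r = p + 1, for which no degree p - r exists. For r < q the bound q <= p + 1
   gives r <= p, and the truncated subtraction p - r is exact. *)
move: hrq; rewrite leq_eqVlt => /predU1P[rq|rq].
  exists (cst 0); split.
  - apply: piecewise_poly_spline_space => //; first exact: sobolev_cst.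
    exact: piecewise_poly_cst.
  - by rewrite rq; apply: sobolevB => //; exact: sobolev_cst.
  - rewrite rq subnn expr0 mul1r.
    by rewrite (_ : u \- _ = u)//; apply/funext => x; rewrite /= subr0.
have [w wP] := sobolev_weak_derivatives hu.
have rp : (r <= p)%N by rewrite -ltnS (leq_trans rq).
(* The sequence is shifted to start at the r-th derivative: q - r derivatives remain, and r
   primitives will later raise the degree p - r to p. *)
have [|i iqr|i iqr e se e0|s [sG sP sE]] :=
    @spline_projection_estimate _ a h n h0 (q - r) (p - r) (fun i => w (r + i)%N).
- by rewrite -subSn// leq_sub2r.
- by have [] := wP (r + i)%N; rewrite // -leq_subRL// ltnW.
- have rS : (r + i.+1 <= q)%N by rewrite -leq_subRL// ltnW.
  have rL : (r + i <= q)%N by rewrite (leq_trans _ rS)// leq_add2l.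
  have [s1 d1] := wP _ rL; have [s2 d2] := wP _ rS.
  apply: weak_derivative1_primitive => //.
  by apply: is_weak_derivative_step d1 _; rewrite -addnS.
rewrite subnKC ?addn0 in sE sP; last exact: ltnW.
have [pps sobs ds] := iter_primitive_spline h0 n0 r sG.
rewrite subnKC// in pps sobs.
have ss := sobolev_sq (lspan_spline_gens h0 n0 sG).2.
have [swr dwr] := wP r (ltnW rq); have [swq dwq] := wP q (leqnn q).
have su := sobolev_sq hu; have ssp := sobolev_sq sobs.
exists (iter r (primitive a) s); split.
- exact: piecewise_poly_spline_space.
- by apply: sobolevB => //; [exact: sobolevS (ltnW rq) hu|exact: sobolevS rp sobs].
- rewrite (sobolev_seminormE (sqB swr ss)); last exact: is_weak_derivativeB.
  rewrite (sobolev_seminormE swq dwq) (le_trans sE)// ler_wpM2r ?nrm_ge0//.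
  (* The sharper factor h^(q-r) is relaxed by monotonicity of powers, from h <= sqrt 2 * h. *)
  rewrite lerXn2r ?nnegrE ?mulr_ge0 ?sqrtr_ge0 ?(ltW h0)//.
  by rewrite ler_peMl ?(ltW h0)// -[leLHS](@sqrtr1 R) ler_sqrt ?ler1n.
Qed.
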